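(* Assume that $f_1(z)=z$. Then for every real number $c<-2$, the set $\mathcal{K}_c$ is disconnected.
   Context: The sequence $(f_n)_{n\ge 0}$ of polynomials $\mathbb{C}\to\mathbb{C}$ is defined by $f_0(z)=z$, $f_1(z)=z$, and $f_n(z)=f_{n-1}(z)f_{n-2}(z)+c$ for $n\ge 2$. The filled-in Julia set is $\mathcal{K}_c=\{z\in\mathbb{C}:\sup_{n\in\mathbb{N}}|f_n(z)|<+\infty\}$. *)

(* Defs.v *)
From HB Require Import structures.
From mathcomp Require Import all_boot all_order all_algebra.
From mathcomp Require Import all_classical all_reals all_analysis.
From mathcomp Require Import complex.

Set Implicit Arguments.
Unset Strict Implicit.
Unset Printing Implicit Defensive.

Import Order.TTheory GRing.Theory Num.Theory numFieldNormedType.Exports.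

Local Open Scope classical_set_scope.
Local Open Scope ring_scope.
Local Open Scope complex_scope.

Fixpoint fib_poly (R : realType) (c : R[i]) (n : nat) : {poly R[i]} :=
  match n with
  | n'.+1 =>
      match n' with
      | n''.+1 => fib_poly c n' * fib_poly c n'' + c%:P
      | 0 => 'X
      end
  | 0 => 'X
  end.

(* [normc] is the [R]-valued modulus; the alias [R[i]^o] carries the topology
   induced by the modulus. *)
Definition filled_julia (R : realType) (c : R[i]) : set R[i]^o :=
  [set z : R[i]^o |
    (ereal_sup [set (ComplexField.Normc.normc (fib_poly c n).[z])%:E | n in [set: nat]] < +oo)%E].

(* Main.v *)
Require Import Defs.
From mathcomp Require Import all_boot all_order all_algebra.
From mathcomp Require Import all_classical all_reals all_analysis.
From mathcomp Require Import complex.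
From mathcomp Require Import lra.
Import Order.TTheory GRing.Theory Num.Theory numFieldNormedType.Exports.
Local Open Scope classical_set_scope.
Local Open Scope ring_scope.
Local Open Scope complex_scope.

(* The two real roots of x ^ 2 + c = x are constant orbits, hence lie in the
   filled Julia set, and they have opposite signs.  The imaginary axis separates
   them: there both |f_2| and |f_3| are at least |c| > 2, and two consecutive
   terms of modulus at least |c| force |f_(n+1)| >= (|c| - 1) |f_n|, which is at
   least |f_n| + (|c| - 2), from then on. *)

Import ComplexField.Normc.

Lemma complex_norm_normc (R : rcfType) (z : R[i]) : `|z| = (normc z)%:C :> R[i].
Proof. by []. Qed.

Lemma normc_real (R : rcfType) (x : R) : normc x%:C = `|x|.
Proof. by rewrite /normc /= expr0n /= addr0 sqrtr_sqr. Qed.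

Lemma ler_norm_Re (R : rcfType) (z : R[i]) : `|complex.Re z| <= normc z.
Proof.
by case: z => a b; rewrite /= -sqrtr_sqr ler_wsqrtr // lerDl sqr_ge0.
Qed.

(** The real part is 1-Lipschitz for the modulus, so [e] itself serves as the radius. *)
Lemma Re_continuous (R : realType) : continuous (@complex.Re R : R[i]^o -> R).
Proof.
move=> z; apply/(@cvgrPdist_lt _ _ _ (nbhs (z : R[i]^o))) => e e0.
apply/nbhs_ballP; exists e%:C; first by rewrite /= ltcR.
move=> w; rewrite /ball /= complex_norm_normc ltcR; apply: le_lt_trans.
by rewrite -raddfB; exact: ler_norm_Re.
Qed.

Lemma fib_polyE (R : realType) (c : R[i]) (n : nat) (z : R[i]) :
  (fib_poly c n.+2).[z] = (fib_poly c n.+1).[z] * (fib_poly c n).[z] + c.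
Proof. by rewrite [fib_poly _ _.+2]/= hornerD hornerM hornerC. Qed.

Lemma fib_poly_fixed (R : realType) (c z : R[i]) (n : nat) :
  z * z + c = z -> (fib_poly c n).[z] = z.
Proof.
move=> fz; suff : (fib_poly c n).[z] = z /\ (fib_poly c n.+1).[z] = z by case.
elim: n => [|n [IH0 IH1]]; first by rewrite hornerX.
by split=> //; rewrite fib_polyE IH0 IH1.
Qed.

Lemma fixed_filled_julia (R : realType) (c z : R[i]) :
  z * z + c = z -> filled_julia c z.
Proof.
move=> fz; apply: (@le_lt_trans _ _ (normc z)%:E); last exact: ltry.
by apply: ge_ereal_sup => _ [n _ <-]; rewrite fib_poly_fixed.
Qed.

Lemma fib_poly_growth (R : realType) (c z : R[i]) (m : nat) :
  2 < normc c ->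
  normc c <= normc (fib_poly c m).[z] ->
  normc c <= normc (fib_poly c m.+1).[z] ->
  forall n, n%:R * (normc c - 2) <= normc (fib_poly c (n + m).+1).[z].
Proof.
move=> c2 h0 h1 n.
suff [_ _] : [/\ normc c <= normc (fib_poly c (n + m)).[z],
                 normc c <= normc (fib_poly c (n + m).+1).[z] &
  n%:R * (normc c - 2) <= normc (fib_poly c (n + m).+1).[z]] by [].
elim: n => [|n [IH0 IH1 IHn]]; first by rewrite mul0r; split=> //; lra.
rewrite addSn.
(* Reverse triangle inequality: with [|f_k| >= |c|] and [|f_(k+1)| >= |c|], one gets [|f_(k+1)|
   |f_k| - |c| >= |c| |f_(k+1)| - |f_(k+1)|]. *)
have step : (normc c - 1) * normc (fib_poly c (n + m).+1).[z]
    <= normc (fib_poly c (n + m).+2).[z].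
  have := lerB_normD ((fib_poly c (n + m).+1).[z] * (fib_poly c (n + m)).[z]) c.
  rewrite -fib_polyE !complex_norm_normc normcM -rmorphB lecR; nra.
split=> //; first by nra.
by rewrite -natr1; nra.
Qed.

(** A finite supremum [M] would bound the linearly growing minorant [n * (|c| - 2)], which fails for
    an integer [n] beyond [M / (|c| - 2)]. *)
Lemma filled_julia_escape (R : realType) (c z : R[i]) (m : nat) :
  2 < normc c ->
  normc c <= normc (fib_poly c m).[z] ->
  normc c <= normc (fib_poly c m.+1).[z] ->
  ~ filled_julia c z.
Proof.
move=> c2 h0 h1; rewrite /filled_julia /=.
move=> Klt; set S := [set _ | _ in _] in Klt.
have Sub n : ((normc (fib_poly c n).[z])%:E <= ereal_sup S)%E.
  by apply: ereal_sup_ubound; exists n.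
have Sfin : ereal_sup S \is a fin_num.
  by rewrite fin_real // Klt andbT (lt_le_trans _ (Sub 0)) // ltNyr.
set M := fine (ereal_sup S).
have SM n : normc (fib_poly c n).[z] <= M by rewrite -lee_fin fineK.
have d0 : 0 < normc c - 2 by lra.
have M0 : 0 <= M / (normc c - 2).
  by rewrite divr_ge0 ?(ltW d0) // (le_trans _ (SM m)) // (le_trans _ h0) //; lra.
have := archi_boundP M0; rewrite ltNge ler_pdivlMr // => /negP; apply.
exact: le_trans (fib_poly_growth _ _ _ _ c2 h0 h1 _) (SM _).
Qed.

(** Escape starts at index 2, since [f_0 = f_1 = z] may be small. For [z = it], [f_2 = c - t^2] is
    real and [f_3 = (c - t^2) it + c] has real part [c]; both real parts are at most [c < 0]. *)
Lemma imaginary_axis_escape (R : realType) (c : R) (z : R[i]) :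
  c < -2 -> complex.Re z = 0 -> ~ filled_julia c%:C z.
Proof.
case: z => x t c2 /= ->.
have nc : normc c%:C = - c by rewrite normc_real ltr0_norm //; lra.
apply: (@filled_julia_escape _ _ _ 2); rewrite ?nc; first by lra.
- apply: le_trans (ler_norm_Re _ _).
  rewrite fib_polyE !hornerX /= ltr0_norm; nra.
- apply: le_trans (ler_norm_Re _ _).
  rewrite !fib_polyE !hornerX /= ltr0_norm; nra.
Qed.

Theorem proposition4p2 (R : realType) (c : R) (hc : c < -2) :
  ~ connected (filled_julia c%:C).
Proof.
(* The fixed points are [(1 + s) / 2] and [(1 - s) / 2]; [s > 1] gives them opposite signs. *)
pose s := Num.sqrt (1 - 4 * c).
have s2 : s ^+ 2 = 1 - 4 * c by rewrite sqr_sqrtr //; lra.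
have s1 : 1 < s.
  rewrite ltNge; apply/negP => s1; have s0 : 0 <= s := sqrtr_ge0 _; nra.
have Kreal x : x * x + c = x -> filled_julia c%:C x%:C.
  by move=> fx; apply: fixed_filled_julia; rewrite -rmorphM -rmorphD fx.
have Kp : filled_julia c%:C ((1 + s) / 2)%:C by apply: Kreal; lra.
have Kn : filled_julia c%:C ((1 - s) / 2)%:C by apply: Kreal; lra.
pose P := [set z : R[i]^o | 0 < complex.Re z].
(* Connectedness would force a nonempty relatively clopen part to be everything, yet the negative
   fixed point lies outside [P]. *)
move=> /(_ (filled_julia c%:C `&` P)) KP.
suff : filled_julia c%:C `&` P = filled_julia c%:C.
  by move=> /seteqP[_ /(_ _ Kn)[_]]; rewrite /P /=; lra.
apply: KP.
- by exists ((1 + s) / 2)%:C; split => //; rewrite /P /=; lra.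
- exists P => //.
  by apply: (@open_comp _ _ (@complex.Re R : R[i]^o -> R) [set x | 0 < x]);
    [move=> z _; exact: Re_continuous|exact: open_gt].
(* The closed half-plane cuts out the same part, because the set misses the imaginary axis. *)
- exists [set z : R[i]^o | 0 <= complex.Re z].
    by apply: (@closed_comp _ _ (@complex.Re R : R[i]^o -> R) [set x | 0 <= x]);
    [move=> z _; exact: Re_continuous|exact: closed_ge].
  apply/seteqP; split=> z [Kz zP]; split=> //; first exact: ltW.
  rewrite /P /= lt_neqAle; apply/andP; split=> //; apply/eqP => z0.
  exact: (@imaginary_axis_escape _ c z hc (esym z0)).
Qed.
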